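(* Let $A\in\mathbf{C}^{n\times n}$ be nonsingular, and let $G_k$ ($k\ge 1$) be the $kn\times kn$ matrices and $C_k$ the $kn\times n$ matrices defined in the context from $A$. Suppose that the nonlinear matrix equation $X+A^{*}\overline{X}^{-1}A=I_{n}$ has a positive definite solution. Then $G_{k}>0$ for all $k\geq 1$, and for every positive definite solution $X$ and every integer $k\geq 1$ there holds $$X<R_{k},\qquad R_{k}:=\begin{cases}I_{n}-C_{k}^{*}\,\overline{G}_{k}^{\,-1}\,C_{k}, & k\text{ even},\\[2pt] I_{n}-C_{k}^{*}\,G_{k}^{-1}\,C_{k}, & k\text{ odd}.\end{cases}$$ Moreover, $R_{k}$ is non-increasing, namely $R_{k+1}\leq R_{k}$ for all $k\geq 1$.
   Context: Notation: $\overline{M}$, $M^{*}$ denote the entrywise conjugate and the conjugate transpose of a complex matrix $M$; $M>0$ means that $M$ is Hermitian positive definite; $M<N$ and $M\le N$ refer to the Loewner order on Hermitian matrices. The matrices $G_k\in\mathbf{C}^{kn\times kn}$ are defined recursively by $G_{1}=I_{n}$ and $$G_{k+1}=\begin{bmatrix}G_{k}&\begin{bmatrix}\mathbf{0}\\ A\end{bmatrix}\\ \begin{bmatrix}\mathbf{0}&A^{*}\end{bmatrix}&I_{n}\end{bmatrix}\ (k\text{ odd}),\qquad G_{k+1}=\begin{bmatrix}G_{k}&\begin{bmatrix}\mathbf{0}\\ \overline{A}\end{bmatrix}\\ \begin{bmatrix}\mathbf{0}&\overline{A}^{*}\end{bmatrix}&I_{n}\end{bmatrix}\ (k\text{ even}),$$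 where $\mathbf{0}$ denotes a zero block of the appropriate size (of size $(k-1)n\times n$ or $n\times(k-1)n$; it is empty when $k=1$, so that $G_2=\begin{bmatrix}I_n&A\\ A^*&I_n\end{bmatrix}$). The matrix $C_k=\begin{bmatrix}\mathbf{0}\\ A\end{bmatrix}\in\mathbf{C}^{kn\times n}$ has last $n\times n$ block $A$ and all other entries zero (for $k=1$, $C_1=A$). *)

(* Defs.v *)
From mathcomp Require Import all_boot all_order all_algebra.
From mathcomp Require Export spectral sesquilinear.
From mathcomp Require Export reals complex.

Set Implicit Arguments.
Unset Strict Implicit.
Unset Printing Implicit Defensive.

Import Order.TTheory GRing.Theory Num.Theory Num.Def.
Local Open Scope ring_scope.
Local Open Scope sesquilinear_scope.

Section Loewner.
Variables (C : numClosedFieldType) (n : nat).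
Implicit Types M N : 'M[C]_n.

(* On a numClosedFieldType, 0 < z and 0 <= z entail that z is real. *)
Definition posdefmx M : Prop :=
  M \is hermsymmx /\
  forall x : 'cV[C]_n, x != 0 -> 0 < (x^t* *m M *m x) 0 0.

Definition possemidefmx M : Prop :=
  M \is hermsymmx /\
  forall x : 'cV[C]_n, 0 <= (x^t* *m M *m x) 0 0.

Definition loewner_lt M N : Prop :=
  [/\ M \is hermsymmx, N \is hermsymmx & posdefmx (N - M)].

Definition loewner_le M N : Prop :=
  [/\ M \is hermsymmx, N \is hermsymmx & possemidefmx (N - M)].

End Loewner.

(* The number k * n, in the form that makes block matrices whose last block
   has size n typecheck without casts: blockdim n k.+1 is blockdim n k + n. *)
Fixpoint blockdim (n k : nat) : nat :=
  if k is k'.+1 then (blockdim n k' + n)%N else 0%N.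

Lemma blockdimE n k : blockdim n k = (k * n)%N.
Proof. by elim: k => //= k ->; rewrite mulSnr. Qed.

Section Blocks.
Variables (C : numClosedFieldType) (n : nat).
Implicit Types A : 'M[C]_n.

(* The block column [0; A] with k blocks; the empty matrix when k = 0. *)
Definition Cmx A (k : nat) : 'M[C]_(blockdim n k, n) :=
  if k is k'.+1 then col_mx (0 : 'M_(blockdim n k', n)) A else 0.

(* G_(k+1) from G_k, for k >= 1. *)
Definition Gstep A (k : nat) (G : 'M[C]_(blockdim n k)) :
    'M[C]_(blockdim n k.+1) :=
  let B := Cmx (if odd k then A else map_mx conjC A) k in
  block_mx G B (B^t*) 1%:M.

(* Meaningful for k >= 1; the value at 0 is the empty matrix. *)
Fixpoint Gmx A (k : nat) : 'M[C]_(blockdim n k) :=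
  if k is j.+1 then
    (if j is 0 as i return 'M_(blockdim n i) -> 'M_(blockdim n i.+1)
     then fun=> 1%:M else @Gstep A _) (Gmx A j)
  else 0.

Definition Rmx A (k : nat) : 'M[C]_n :=
  if odd k then 1%:M - (Cmx A k)^t* *m invmx (Gmx A k) *m Cmx A k
  else 1%:M - (Cmx A k)^t* *m invmx (map_mx conjC (Gmx A k)) *m Cmx A k.

Definition posdef_solution A (X : 'M[C]_n) : Prop :=
  posdefmx X /\ X + A^t* *m invmx (map_mx conjC X) *m A = 1%:M.

End Blocks.

(* Main.v *)
Require Import Defs.
From mathcomp Require Import all_boot all_order all_algebra.
From mathcomp Require Import reals complex.
Import GRing.Theory.
Local Open Scope ring_scope.

(** Put F(X) = 1 - A^* (conj X)^-1 A ([Fmap]).  The positive definite solutions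
    of the equation are the positive definite fixed points of F, and the whole
    theorem says that iterating F from the identity decreases and stays above
    all of them:

    - [Rmx A k] is the k-th iterate of F at 1.  Indeed the Schur
      complement of G_k in G_(k+1) is R_k, up to conjugation when k is even.
      The last diagonal block of the inverse of a block matrix is the inverse
      of the Schur complement, and C_(k+1) only sees that last block of
      G_(k+1)^-1, so that R_(k+1) = F(R_k) ([Rmx_rec]).  The recursion even
      starts at k = 0, where G_0 is empty and R_0 = 1.

    - Inversion reverses the Loewner order on positive definite matrices
      ([possemidef_inv_sub], [posdef_inv_sub]), hence F is monotone, and
      strictly so because A is nonsingular.

    A solution X satisfies X = F(X) < 1 = R_0, whence X < R_k for all k by
    induction; in particular R_k > 0, so G_k > 0 implies G_(k+1) > 0 by the
    Schur criterion ([posdef_block]).  Finally R_1 = F(1) <= 1 = R_0 propagates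
    to R_(k+1) <= R_k. *)

Import Order.TTheory Num.Theory Num.Def.
Local Open Scope sesquilinear_scope.

Local Notation cj := (map_mx conjC).

(** * Conjugation and adjoint *)

Section Adjoint.
Context {C : numClosedFieldType}.

Lemma cjK m n : involutive (fun M : 'M[C]_(m, n) => cj M).
Proof. by move=> M; apply/matrixP => i j; rewrite !mxE conjCK. Qed.

Lemma adjmxM m n p (M : 'M[C]_(m, n)) (N : 'M[C]_(n, p)) :
  (M *m N)^t* = N^t* *m M^t*.
Proof. by rewrite trmx_mul map_mxM. Qed.

Lemma adjmxD m n (M N : 'M[C]_(m, n)) : (M + N)^t* = M^t* + N^t*.
Proof. by rewrite linearD /= map_mxD. Qed.

Lemma adjmx_cj m n (M : 'M[C]_(m, n)) : (cj M)^t* = cj (M^t* ).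
Proof. by rewrite map_trmx. Qed.

Lemma adjmx1 n : (1%:M : 'M[C]_n)^t* = 1%:M.
Proof. by rewrite trmx1 map_mx1. Qed.

Lemma adjmx_inv n (M : 'M[C]_n) : (invmx M)^t* = invmx (M^t* ).
Proof. by rewrite trmx_inv map_invmx. Qed.

Lemma adjmx_col m1 m2 n (M : 'M[C]_(m1, n)) (N : 'M[C]_(m2, n)) :
  (col_mx M N)^t* = row_mx (M^t* ) (N^t* ).
Proof. by rewrite tr_col_mx map_row_mx. Qed.

Lemma hermsymP n (M : 'M[C]_n) : M \is hermsymmx <-> M^t* = M.
Proof.
split=> [/is_hermitianmxP {2}->|eM]; first by rewrite expr0 scale1r.
by apply/is_hermitianmxP; rewrite expr0 scale1r eM.
Qed.

End Adjoint.

(** * Positive definite and semidefinite matrices *)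

Section Definite.
Context {C : numClosedFieldType}.

Lemma quadform_congr m n (P : 'M[C]_(m, n)) (M : 'M[C]_m) (x : 'cV[C]_n) :
  x^t* *m (P^t* *m M *m P) *m x = (P *m x)^t* *m M *m (P *m x).
Proof. by rewrite adjmxM !mulmxA. Qed.

Lemma quadform_cj n (M : 'M[C]_n) (x : 'cV[C]_n) :
  x^t* *m cj M *m x = cj ((cj x)^t* *m M *m cj x).
Proof. by rewrite !map_mxM !cjK map_trmx. Qed.

Lemma quadformD n (M N : 'M[C]_n) (x : 'cV[C]_n) :
  (x^t* *m (M + N) *m x) 0 0
    = (x^t* *m M *m x) 0 0 + (x^t* *m N *m x) 0 0.
Proof. by rewrite mulmxDr mulmxDl [LHS]mxE. Qed.

Lemma herm_congr {m n} (P : 'M[C]_(m, n)) (M : 'M[C]_m) :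
  M \is hermsymmx -> P^t* *m M *m P \is hermsymmx.
Proof. by move=> /hermsymP eM; apply/hermsymP; rewrite !adjmxM trmxCK eM mulmxA. Qed.

Lemma herm_cj n (M : 'M[C]_n) : M \is hermsymmx -> cj M \is hermsymmx.
Proof. by move=> /hermsymP eM; apply/hermsymP; rewrite adjmx_cj eM. Qed.

Lemma hermD n (M N : 'M[C]_n) :
  M \is hermsymmx -> N \is hermsymmx -> M + N \is hermsymmx.
Proof.
by move=> /hermsymP eM /hermsymP eN; apply/hermsymP; rewrite adjmxD eM eN.
Qed.

Lemma posdefW {n} {M : 'M[C]_n} : posdefmx M -> possemidefmx M.
Proof.
case=> hM pM; split=> // x; have [->|x0] := eqVneq x 0; last exact/ltW/pM.
by rewrite mulmx0 mxE.
Qed.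

Lemma posdef_possemidefD {n} {M N : 'M[C]_n} :
  posdefmx M -> possemidefmx N -> posdefmx (M + N).
Proof.
move=> [hM pM] [hN pN]; split=> [|x x0]; first exact: hermD.
by rewrite quadformD ltr_wpDr ?pN ?pM.
Qed.

Lemma possemidefD n (M N : 'M[C]_n) :
  possemidefmx M -> possemidefmx N -> possemidefmx (M + N).
Proof.
move=> [hM pM] [hN pN]; split=> [|x]; first exact: hermD.
by rewrite quadformD addr_ge0 ?pN ?pM.
Qed.

Lemma possemidef_congr {m n} (P : 'M[C]_(m, n)) {M : 'M[C]_m} :
  possemidefmx M -> possemidefmx (P^t* *m M *m P).
Proof.
move=> [hM pM]; split=> [|x]; first exact: herm_congr.
by rewrite quadform_congr.
Qed.

Lemma posdef_congr {n} {P M : 'M[C]_n} :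
  P \in unitmx -> posdefmx M -> posdefmx (P^t* *m M *m P).
Proof.
move=> uP [hM pM]; split=> [|x x0]; first exact: herm_congr.
rewrite quadform_congr pM //; apply: contra x0 => /eqP Px0.
by rewrite -(mulKmx uP x) Px0 mulmx0.
Qed.

Lemma possemidef_cj {n} {M : 'M[C]_n} : possemidefmx M -> possemidefmx (cj M).
Proof.
move=> [hM pM]; split=> [|x]; first exact: herm_cj.
by rewrite quadform_cj mxE conjC_ge0.
Qed.

Lemma posdef_cj {n} {M : 'M[C]_n} : posdefmx M -> posdefmx (cj M).
Proof.
move=> [hM pM]; split=> [|x x0]; first exact: herm_cj.
have q0 : 0 < ((cj x)^t* *m M *m cj x) 0 0 by rewrite pM ?map_mx_eq0.
by rewrite quadform_cj mxE geC0_conj ?ltW.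
Qed.

Lemma posdef_unit {n} {M : 'M[C]_n} : posdefmx M -> M \in unitmx.
Proof.
move=> [_ pM]; rewrite -unitmx_tr -row_free_unit; apply: inj_row_free => v vM.
apply: trmx_inj; rewrite trmx0; apply/eqP/negPn/negP => v0.
have Mv : M *m v^T = 0 by rewrite -[M]trmxK -trmx_mul vM trmx0.
by have := pM _ v0; rewrite -mulmxA Mv mulmx0 mxE ltxx.
Qed.

(** M^-1 is the congruence of M by M^-1 itself. *)
Lemma posdef_inv {n} {M : 'M[C]_n} : posdefmx M -> posdefmx (invmx M).
Proof.
move=> pM; have uM := posdef_unit pM; have /hermsymP eM := pM.1.
have -> : invmx M = (invmx M)^t* *m M *m invmx M.
  by rewrite adjmx_inv eM mulVmx // mul1mx.
by apply: posdef_congr pM; rewrite unitmx_inv.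
Qed.

(** For Hermitian N this is a congruence of a matrix that inherits the sign of
    N - M when M > 0, so that no square root is needed to compare inverses. *)
Lemma invmx_sub n (M N : 'M[C]_n) : M \in unitmx -> N \in unitmx ->
  invmx M - invmx N
    = invmx N *m ((N - M) + (N - M) *m invmx M *m (N - M)) *m invmx N.
Proof.
move=> uM uN.
have -> : (N - M) + (N - M) *m invmx M *m (N - M) = (N - M) *m invmx M *m N.
  by rewrite [X in _ + X]mulmxBr mulmxKV // addrC subrK.
by rewrite !mulmxA mulmxK // mulmxBr mulVmx // mulmxBl mul1mx mulmxK.
Qed.

Lemma possemidef_inv_sub {n} {M N : 'M[C]_n} :
  posdefmx M -> posdefmx N -> possemidefmx (N - M) ->
  possemidefmx (invmx M - invmx N).
Proof.
move=> pM pN pD; have /hermsymP eN := pN.1; have /hermsymP eD := pD.1.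
rewrite invmx_sub ?posdef_unit // -{1}eN -adjmx_inv; apply: possemidef_congr.
apply: possemidefD => //; rewrite -{1}eD.
exact: possemidef_congr (posdefW (posdef_inv pM)).
Qed.

Lemma posdef_inv_sub {n} {M N : 'M[C]_n} :
  posdefmx M -> posdefmx N -> posdefmx (N - M) ->
  posdefmx (invmx M - invmx N).
Proof.
move=> pM pN pD; have /hermsymP eN := pN.1; have /hermsymP eD := pD.1.
rewrite invmx_sub ?posdef_unit // -{1}eN -adjmx_inv.
apply: posdef_congr; first by rewrite unitmx_inv posdef_unit.
apply: posdef_possemidefD => //; rewrite -{1}eD.
exact: possemidef_congr (posdefW (posdef_inv pM)).
Qed.

End Definite.

(** * Schur complements *)

Section Schur.
Context {C : numClosedFieldType}.

Definition schur {m n} (G : 'M[C]_m) (B : 'M[C]_(m, n)) (D : 'M[C]_n) :=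
  D - B^t* *m invmx G *m B.

Lemma schur_cj {m n} (G : 'M[C]_m) (B : 'M[C]_(m, n)) (D : 'M[C]_n) :
  schur (cj G) (cj B) (cj D) = cj (schur G B D).
Proof. by rewrite /schur map_mxB !map_mxM adjmx_cj map_invmx. Qed.

Lemma posdef_block_diag m n (G : 'M[C]_m) (S : 'M[C]_n) :
  posdefmx G -> posdefmx S -> posdefmx (block_mx G 0 0 S).
Proof.
move=> pG pS; split=> [|x].
  have /hermsymP eG := pG.1; have /hermsymP eS := pS.1.
  by apply/hermsymP; rewrite tr_block_mx map_block_mx eG eS !trmx0 !map_mx0.
rewrite -[x]vsubmxK; move: (usubmx x) (dsubmx x) => u v uv0.
rewrite adjmx_col mul_row_block !mulmx0 addr0 add0r mul_row_col [ltRHS]mxE.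
have [u0|u0] := eqVneq u 0; last by rewrite ltr_wpDr ?(posdefW pS).2 ?pG.2.
rewrite ltr_wpDl ?(posdefW pG).2 ?pS.2 //.
by apply: contra uv0 => /eqP->; rewrite u0 col_mx0.
Qed.

(** The block LDL factorization makes the block matrix a congruence of
    diag(G, S), where S is the Schur complement. *)
Lemma posdef_block {m n} {G : 'M[C]_m} {B : 'M[C]_(m, n)} {D : 'M[C]_n} :
  posdefmx G -> posdefmx (schur G B D) -> posdefmx (block_mx G B (B^t* ) D).
Proof.
move=> pG pS; have uG := posdef_unit pG; have /hermsymP eG := pG.1.
pose L : 'M[C]_(m + n) := block_mx 1%:M (invmx G *m B) 0 1%:M.
have -> : block_mx G B (B^t* ) D
          = L^t* *m block_mx G 0 0 (schur G B D) *m L.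
  rewrite tr_block_mx map_block_mx adjmxM adjmx_inv eG !adjmx1 trmx0 map_mx0.
  rewrite !mulmx_block !(mul1mx, mulmx1, mul0mx, mulmx0, addr0, add0r).
  by rewrite mulmxKV // mulKVmx // mulmxA /schur addrC subrK.
apply: posdef_congr; last exact: posdef_block_diag.
by rewrite unitmxE det_ublock !det1 mulr1 unitr1.
Qed.

(** [0; A]^* H^-1 [0; A] only involves the last diagonal block of H^-1, which is
    the inverse of the Schur complement of G in H.  This is what turns the
    growing matrices G_k into a recursion in fixed dimension n. *)
Lemma schur_last_block {m n p} {G : 'M[C]_m} {B : 'M[C]_(m, n)} {D : 'M[C]_n}
    (A : 'M[C]_(n, p)) (E : 'M[C]_p) :
  posdefmx G -> posdefmx (schur G B D) ->
  schur (block_mx G B (B^t* ) D) (col_mx 0 A) E = schur (schur G B D) A E.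
Proof.
move=> pG pS; have uH := posdef_unit (posdef_block pG pS).
have uG := posdef_unit pG; have uS := posdef_unit pS.
(* The solution of [[G, B], [B^*, D]] (y, z) = (0, A), by block elimination. *)
pose z := invmx (schur G B D) *m A.
have Hz : block_mx G B (B^t* ) D *m col_mx (- (invmx G *m B *m z)) z
          = col_mx 0 A.
  rewrite mul_block_col !mulmxN !mulmxA mulmxV // mul1mx addNr.
  by rewrite addrC -!mulmxBl mulmxV ?mul1mx.
rewrite {1}/schur -mulmxA -[in X in _ *m X]Hz mulKmx //.
by rewrite adjmx_col trmx0 map_mx0 mul_row_col mul0mx add0r mulmxA.
Qed.

End Schur.

(** * The fixed-point map *)

Section FixedPointMap.
Context {C : numClosedFieldType} {n : nat}.
Implicit Types (A X Y : 'M[C]_n).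

Definition Fmap A X : 'M[C]_n := schur (cj X) A 1%:M.

Lemma Fmap_sub A X Y :
  Fmap A Y - Fmap A X = A^t* *m cj (invmx X - invmx Y) *m A.
Proof.
rewrite map_mxB !map_invmx mulmxBr mulmxBl /Fmap /schur.
by rewrite opprB addrC addrA subrK.
Qed.

Lemma posdef_solution_fix {A X} : posdef_solution A X -> Fmap A X = X.
Proof. by case=> _ eX; rewrite /Fmap /schur -eX addrK. Qed.

Lemma Fmap_le {A X Y} : posdefmx X -> posdefmx Y ->
  possemidefmx (Y - X) -> possemidefmx (Fmap A Y - Fmap A X).
Proof.
move=> pX pY pD; rewrite Fmap_sub.
exact/possemidef_congr/possemidef_cj/possemidef_inv_sub.
Qed.

Lemma Fmap_lt {A X Y} : A \in unitmx -> posdefmx X -> posdefmx Y ->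
  posdefmx (Y - X) -> posdefmx (Fmap A Y - Fmap A X).
Proof.
move=> uA pX pY pD; rewrite Fmap_sub.
exact/posdef_congr/posdef_cj/posdef_inv_sub.
Qed.

Lemma one_sub_Fmap A X : 1%:M - Fmap A X = A^t* *m cj (invmx X) *m A.
Proof. by rewrite /Fmap /schur subKr map_invmx. Qed.

End FixedPointMap.

(** * The matrices R_k as iterates *)

Section Iterates.
Context {C : numClosedFieldType} {n : nat}.
Implicit Types (A X : 'M[C]_n).

(** The off-diagonal column of G_(k+1). *)
Definition Bmx A k : 'M[C]_(blockdim n k, n) :=
  Cmx (if odd k then A else cj A) k.

Lemma Cmx_cj A k : Cmx (cj A) k = cj (Cmx A k).
Proof. by case: k => [|k] /=; rewrite ?map_col_mx map_mx0. Qed.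

(** Unlike the recursive definition, this covers k = 0, where three of the
    blocks are empty; all inductions can thus start from R_0 = 1. *)
Lemma GmxS A k :
  Gmx A k.+1 = block_mx (Gmx A k) (Bmx A k) ((Bmx A k)^t* ) 1%:M.
Proof.
case: k => [|k] //=; apply/matrixP => i j.
case: (split_ordP i) (split_ordP j) => [[]//|i' ->] [[]//|j' ->].
by rewrite block_mxEdr !mxE.
Qed.

Lemma Rmx0 A : Rmx A 0 = 1%:M.
Proof. by rewrite /Rmx /= mulmx0 subr0. Qed.

Lemma RmxE A k :
  Rmx A k = schur (if odd k then Gmx A k else cj (Gmx A k)) (Cmx A k) 1%:M.
Proof. by rewrite /Rmx; case: (odd k). Qed.

Lemma schur_Gmx A k :
  schur (Gmx A k) (Bmx A k) 1%:M = if odd k then Rmx A k else cj (Rmx A k).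
Proof.
rewrite RmxE /Bmx; case: (odd k) => //.
by rewrite Cmx_cj -schur_cj cjK map_mx1.
Qed.

Lemma posdef_schur_Gmx A k :
  posdefmx (Rmx A k) -> posdefmx (schur (Gmx A k) (Bmx A k) 1%:M).
Proof. by rewrite schur_Gmx; case: (odd k) => // /posdef_cj. Qed.

Lemma posdef_GmxS A k :
  posdefmx (Gmx A k) -> posdefmx (Rmx A k) -> posdefmx (Gmx A k.+1).
Proof. by move=> pG pR; rewrite GmxS; apply/posdef_block/posdef_schur_Gmx. Qed.

(** The conjugations in the definitions of G_k and R_k are placed so that both
    parities of k give the same recursion: for odd k the conjugate in [Fmap]
    comes from the one on G_(k+1), for even k from [schur_Gmx]. *)
Lemma Rmx_rec {A k} :
  posdefmx (Gmx A k) -> posdefmx (Rmx A k) -> Rmx A k.+1 = Fmap A (Rmx A k).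
Proof.
move=> pG /posdef_schur_Gmx pS; have eR := schur_Gmx A k.
rewrite RmxE GmxS /Fmap [odd _]/= [Cmx A k.+1]/=.
case: (odd k) eR => /= eR; last by rewrite (schur_last_block _ _ pG pS) eR.
apply: (can_inj (@cjK C n n)); rewrite -!schur_cj !cjK map_col_mx map_mx0 map_mx1.
by rewrite (schur_last_block _ _ pG pS) eR.
Qed.

(** The two claims need a simultaneous induction: X < R_k makes R_k positive
    definite, which gives G_(k+1) > 0, and the recursion for R_(k+1) inverts
    G_k. *)
Lemma posdef_Gmx_Rmx_sub {A X} k : A \in unitmx -> posdef_solution A X ->
  posdefmx (Gmx A k) /\ posdefmx (Rmx A k - X).
Proof.
move=> uA sX; have pX := sX.1; have fX := posdef_solution_fix sX.
elim: k => [|k [pG pRX]].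
  rewrite Rmx0 -{1}fX one_sub_Fmap; split.
    split=> [|x]; first by apply/hermsymP/matrixP => -[].
    by rewrite [x]flatmx0 eqxx.
  exact/posdef_congr/posdef_cj/posdef_inv.
have pR : posdefmx (Rmx A k).
  by rewrite -[Rmx A k](subrK X); exact: posdef_possemidefD (posdefW pX).
split; first exact: posdef_GmxS.
by rewrite Rmx_rec // -[X in _ - X]fX; apply: Fmap_lt.
Qed.

End Iterates.

Theorem theorem4 (R : realType) (n : nat) (A : 'M[R[i]]_n)
    (hA : A \in unitmx)
    (hsol : exists X : 'M[R[i]]_n, posdef_solution A X) :
  [/\ forall k : nat, (1 <= k)%N -> posdefmx (Gmx A k),
      forall X : 'M[R[i]]_n, posdef_solution A X ->
        forall k : nat, (1 <= k)%N -> loewner_lt X (Rmx A k)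
    & forall k : nat, (1 <= k)%N -> loewner_le (Rmx A k.+1) (Rmx A k)].
Proof.
have [X sX] := hsol.
have pG k : posdefmx (Gmx A k) := (posdef_Gmx_Rmx_sub k hA sX).1.
have pR k : posdefmx (Rmx A k).
  rewrite -[Rmx A k](subrK X).
  exact: posdef_possemidefD (posdef_Gmx_Rmx_sub k hA sX).2 (posdefW sX.1).
split=> [k _|Y sY k _|k _]; first exact: pG.
  by split; [exact: sY.1.1 | exact: (pR k).1 |
             exact: (posdef_Gmx_Rmx_sub k hA sY).2].
split; [exact: (pR _).1 | exact: (pR _).1 |].
have recR j : Rmx A j.+1 = Fmap A (Rmx A j) by exact: Rmx_rec.
elim: k => [|k IH].
  rewrite recR Rmx0 one_sub_Fmap.
  apply/possemidef_congr/possemidef_cj/posdefW/posdef_inv.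
  by rewrite -(Rmx0 A).
by rewrite (recR k.+1) [X in X - _]recR; apply: Fmap_le.
Qed.
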